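(* For any trees $T_1$ and $T_2$, $\gamma_P(T_1)\,\gamma_P(T_2) \leq \gamma_P(T_1 \Box T_2)$.
   Context: All graphs are simple and finite, with nonempty vertex set. For a graph $G$ and $S\subseteq V(G)$, vertices are observed by the following rules. Initialization (domination) step, applied once: all vertices in $S$ and all neighbors of vertices in $S$ are observed. Propagation (zero forcing) step, applied repeatedly until no further vertex can be observed: every vertex which is the only unobserved neighbor of some observed vertex becomes observed. The set $S$ is a power dominating set of $G$ if every vertex of $G$ is eventually observed. The power domination number $\gamma_P(G)$ is the minimum cardinality of a power dominating set of $G$. The Cartesian product $G\Box H$ has vertex set $\{(g,h) : g\in V(G), h\in V(H)\}$; two vertices $(g_1,h_1)$ and $(g_2,h_2)$ are adjacent if either $g_1=g_2$ and $h_1h_2\in E(H)$, or $h_1=h_2$ and $g_1g_2\in E(G)$. *)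

(* Defs.v *)
From mathcomp Require Import all_boot.

Set Implicit Arguments.
Unset Strict Implicit.
Unset Printing Implicit Defensive.

Record graph := Graph {
  vertex :> finType;
  adj : rel vertex;
  adj_sym : symmetric adj;
  adj_irr : irreflexive adj;
  vertex_gt0 : 0 < #|vertex|
}.

Definition neighbors (G : graph) (v : G) : {set G} := [set w | adj v w].

Definition connected (G : graph) : Prop :=
  forall x y : G, connect (@adj G) x y.

(* [ucycle] also accepts the empty sequence and the sequence [:: x; y] for an
   edge xy; the cycles of a simple graph are those with at least 3 vertices. *)
Definition acyclic (G : graph) : Prop :=
  forall c : seq G, ucycle (@adj G) c -> size c < 3.

Definition is_tree (G : graph) : Prop := connected G /\ acyclic G.

Section PowerDomination.
Variable G : graph.
Implicit Types S O : {set G}.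

Definition domination S : {set G} := S :|: \bigcup_(v in S) neighbors v.

Definition propagation O : {set G} :=
  O :|: [set w | [exists v in O, neighbors v :\: O == [set w]]].

(* #|G| rounds suffice to reach a stable set, see propagation_observed. *)
Definition observed S : {set G} := iter #|G| propagation (domination S).

Definition power_dominating S : bool := observed S == [set: G].

Definition power_domination_number : nat :=
  #|[arg min_(S < [set: G] | power_dominating S) #|S| ]|.

Lemma sub_propagation O : O \subset propagation O.
Proof. exact: subsetUl. Qed.

Lemma propagation_observed S : propagation (observed S) = observed S.
Proof.
have main n : propagation (iter n propagation (domination S)) =
    iter n propagation (domination S) \/
    n <= #|iter n propagation (domination S)|.
  elim: n => [|n [IH|IH]]; [by right | by left; rewrite /= !IH |].
  set A := iter n _ _ in IH *; rewrite /= -/A.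
  have [eA|neA] := eqVneq (propagation A) A; first by left; rewrite !eA.
  right; apply: leq_ltn_trans IH _; apply: proper_card.
  by rewrite properEneq eq_sym neA sub_propagation.
case: (main #|G|) => // leG; rewrite /observed.
set A := iter _ _ _ in leG *.
have -> : A = setT by apply/eqP; rewrite eqEcard subsetT cardsT.
by apply/eqP; rewrite eqEsubset subsetT sub_propagation.
Qed.

Lemma power_dominatingT : power_dominating [set: G].
Proof.
rewrite /power_dominating eqEsubset subsetT /= /observed.
elim: #|G| => [|n IH] /=; first exact: subsetUl.
exact: subset_trans IH (sub_propagation _).
Qed.

Lemma power_domination_numberP :
  (exists2 S, power_dominating S & #|S| = power_domination_number) /\
  (forall S, power_dominating S -> power_domination_number <= #|S|).
Proof.
rewrite /power_domination_number.
by case: arg_minnP => [|S pS minS]; [exact: power_dominatingT | split=> //; exists S].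
Qed.

End PowerDomination.

Section CartesianProduct.
Variables G H : graph.

Definition cartesian_adj : rel (G * H) := fun x y =>
  (x.1 == y.1) && adj x.2 y.2 || (x.2 == y.2) && adj x.1 y.1.

Lemma cartesian_adj_sym : symmetric cartesian_adj.
Proof.
move=> x y; rewrite /cartesian_adj.
by rewrite (eq_sym x.1) (eq_sym x.2) (adj_sym x.1) (adj_sym x.2).
Qed.

Lemma cartesian_adj_irr : irreflexive cartesian_adj.
Proof. by move=> x; rewrite /cartesian_adj !adj_irr !andbF. Qed.

Lemma cartesian_vertex_gt0 : 0 < #|{: G * H}|.
Proof. by rewrite card_prod muln_gt0 !vertex_gt0. Qed.

Definition cartesian_product : graph :=
  Graph cartesian_adj_sym cartesian_adj_irr cartesian_vertex_gt0.

End CartesianProduct.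

(* Main.v *)
Require Import Defs.
From mathcomp Require Import all_boot.

Set Implicit Arguments.
Unset Strict Implicit.
Unset Printing Implicit Defensive.

(** Power domination has a dual object.  A fort is a nonempty set [F] such that
no vertex outside [F] has exactly one neighbor in [F]: if all of [F] is
unobserved, then no propagation step can enter it, so a power dominating set
must meet the closed neighborhood of every fort.  Hence a family of forts with
pairwise disjoint closed neighborhoods bounds the power domination number from
below by its size ([fort_packing_bound]).

Such families multiply.  If [A] and [B] are forts, then so is [A * B] in the
Cartesian product, because a vertex outside [A * B] with a neighbor in it has exactly
one coordinate in its fort and sees [A * B] along a copy of the other fort; and the closed
neighborhood of [A * B] lies in the product of those of [A] and [B], so
disjointness is inherited ([fort_packing_product]).  It remains to see that for
a forest weak duality is tight: some family of forts with disjoint closed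
neighborhoods has as many members as some power dominating set
([acyclic_packing]).

Orient each edge of the forest from child to parent and label the vertices
upwards.  A needy vertex has to be observed from above, an idle one gets
observed from below but spends its propagation step on a needy child, and a
forcing one is chosen or gets observed from below, and observes its parent.  The centers are
the vertices with at least two needy children, together with the needy roots.
They form a power dominating set: the labels are justified upwards, and then
the needy vertices become observed downwards
([centers_power_dominating]).  Conversely each needy vertex can be traced
upwards, through needy and idle vertices, until a center is met or the trace
stops; the needy vertices traced to a given center form a fort whose closed
neighborhood consists of vertices traced to the same center
([centers_packing]). *)

(** * Forts and lower bounds *)

Definition fort (G : graph) (F : {set G}) : Prop :=
  F != set0 /\ forall v, v \notin F -> #|neighbors v :&: F| != 1.

(** The members of the packing are the forts [F i] for [i \in J]; the
domination step computes closed neighborhoods. *)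
Definition fort_packing (G : graph) (I : finType) (J : {set I})
    (F : I -> {set G}) : Prop :=
  {in J, forall i, fort (F i)} /\
  {in J &, forall i j v,
     v \in domination (F i) -> v \in domination (F j) -> i = j}.

Lemma dominationP (G : graph) (A : {set G}) v :
  reflect (v \in A \/ exists2 w, w \in A & adj w v) (v \in domination A).
Proof.
rewrite in_setU; apply: (iffP orP) => -[vA|]; [by left | | by left |].
  by case/bigcupP => w wA; rewrite inE => wv; right; exists w.
by case=> w wA wv; right; apply/bigcupP; exists w; rewrite ?inE.
Qed.

(** Otherwise the domination step observes nothing of the fort, and neither
does any propagation step: the first vertex of the fort to be observed would be
the only neighbor in the fort of some vertex outside it. *)
Lemma power_dominating_meets_fort (G : graph) (S F : {set G}) :
  power_dominating S -> fort F -> exists2 v, v \in S & v \in domination F.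
Proof.
move=> /eqP Sobs [F0 fortF]; apply/exists_inP.
apply: contraNT F0 => /exists_inPn noS.
suff dis n : [disjoint iter n (@propagation G) (domination S) & F].
  have := dis #|G|; rewrite -/(observed S) Sobs -setI_eq0 setTI.
  by move=> /eqP->.
elim: n => [|n IH] /=.
  rewrite disjoint_subset; apply/subsetP=> v /dominationP vS.
  apply/negP=> vF; case: vS => [vS|[w wS wv]].
    by have /negP[] := noS v vS; apply/dominationP; left.
  have /negP[] := noS w wS; apply/dominationP; right.
  by exists v; rewrite // adj_sym.
set O := iter n _ _ in IH *.
rewrite disjoint_subset; apply/subsetP=> w; rewrite in_setU inE.
case/orP=> [wO|/exists_inP[v vO /eqP nv]]; first
  by rewrite !inE (disjointFr IH wO).
apply/negP=> wF; have vF : v \notin F by rewrite (disjointFr IH vO).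
have /negP[] := fortF v vF; apply/cards1P; exists w.
apply/setP=> x; rewrite in_setI; apply/andP/idP => [[vx xF]|].
  by rewrite -nv in_setD vx (disjointFl IH xF).
rewrite in_set1 => /eqP->; split=> //.
have : w \in neighbors v :\: O by rewrite nv set11.
by rewrite in_setD => /andP[].
Qed.

(** Choosing for each fort a vertex of an optimal set in its closed
neighborhood is injective, since the neighborhoods are disjoint. *)
Lemma fort_packing_bound (G : graph) (I : finType) (J : {set I})
    (F : I -> {set G}) :
  fort_packing J F -> #|J| <= power_domination_number G.
Proof.
case=> fortF disF; have [[S pS <-] _] := power_domination_numberP G.
pose s i := [pick v in S | v \in domination (F i)].
have sP i : i \in J ->
    exists v, [/\ s i = Some v, v \in S & v \in domination (F i)].
  move=> iJ; rewrite /s; case: pickP => [v /andP[vS vF]|no]; first by exists v.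
  have [v vS vF] := power_dominating_meets_fort pS (fortF i iJ).
  by have := no v; rewrite /= vS vF.
rewrite -(card_in_imset (f := s) (D := J)); last first.
  move=> i j iJ jJ eij.
  have [v [sv _ vi]] := sP i iJ; have [w [sw _ wj]] := sP j jJ.
  move: eij wj; rewrite sv sw => -[<-] vj; exact: disF vi vj.
rewrite -(card_imset _ (@Some_inj _ : injective (@Some G))).
apply/subset_leq_card/subsetP => _ /imsetP[i iJ ->].
by have [v [-> vS _]] := sP i iJ; apply: imset_f.
Qed.

(** * Forts in Cartesian products *)

(** The neighbors in [A * B] of an outside vertex [(x, y)] are a copy of the
neighbors of [y] in [B] if [x \in A], a copy of the neighbors of [x] in [A] if
[y \in B], and there are none if neither holds. *)
Lemma fort_product (G H : graph) (A : {set G}) (B : {set H}) :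
  fort A -> fort B -> fort (setX A B : {set cartesian_product G H}).
Proof.
move=> [/set0Pn[a aA] fA] [/set0Pn[b bB] fB]; split.
  by apply/set0Pn; exists (a, b); rewrite in_setX aA bB.
case=> x y; rewrite in_setX => xy.
case: (boolP (x \in A)) xy => [xA /= yB|xA _].
  suff -> : neighbors ((x, y) : cartesian_product G H) :&: setX A B
            = [set (x, z) | z in neighbors y :&: B].
    by rewrite card_imset; [exact: fB | move=> z z' []].
  apply/setP=> -[x' y']; rewrite !inE /= /cartesian_adj /=.
  apply/idP/imsetP => [/andP[nb /andP[x'A y'B]]|[z]].
    case/orP: nb => /andP[/eqP e e']; last by rewrite e y'B in yB.
    by exists y'; rewrite ?inE ?e' ?y'B ?e.
  by rewrite !inE => /andP[yz zB] [-> ->]; rewrite eqxx yz xA zB.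
case: (boolP (y \in B)) => yB.
  suff -> : neighbors ((x, y) : cartesian_product G H) :&: setX A B
            = [set (z, y) | z in neighbors x :&: A].
    by rewrite card_imset; [exact: fA | move=> z z' []].
  apply/setP=> -[x' y']; rewrite !inE /= /cartesian_adj /=.
  apply/idP/imsetP => [/andP[nb /andP[x'A y'B]]|[z]].
    case/orP: nb => /andP[/eqP e e']; first by rewrite e x'A in xA.
    by exists x'; rewrite ?inE ?e' ?x'A ?e.
  by rewrite !inE => /andP[xz zA] [-> ->]; rewrite eqxx xz yB zA orbT.
suff -> : neighbors ((x, y) : cartesian_product G H) :&: setX A B = set0.
  by rewrite cards0.
apply/setP=> -[x' y']; rewrite !inE /= /cartesian_adj /=.
apply/negP=> /andP[/orP[]/andP[/eqP e _] /andP[x'A y'B]].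
  by rewrite e x'A in xA.
by rewrite e y'B in yB.
Qed.

Lemma domination_product (G H : graph) (A : {set G}) (B : {set H}) x y :
  (x, y) \in domination (setX A B : {set cartesian_product G H}) ->
  x \in domination A /\ y \in domination B.
Proof.
case/dominationP => [|[[x' y']]]; rewrite in_setX => /andP[/= xA yB].
  by split; apply/dominationP; left.
case/orP=> /andP[/= /eqP e ad]; rewrite -e; split; apply/dominationP;
  by [left | right; [exists y' | exists x'] | right; exists x' | right; exists y'].
Qed.

Lemma fort_packing_product (G H : graph) (I K : finType) (J : {set I})
    (L : {set K}) (A : I -> {set G}) (B : K -> {set H}) :
  fort_packing J A -> fort_packing L B ->
  fort_packing (setX J L)
    (fun ik => setX (A ik.1) (B ik.2) : {set cartesian_product G H}).
Proof.
move=> [fA dA] [fB dB]; split.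
  by case=> i k; rewrite in_setX => /andP[iJ kL]; apply: fort_product; auto.
case=> i k [i' k']; rewrite !in_setX => /andP[/= iJ kL] /andP[/= i'J k'L] [x y].
move=> /domination_product[xA yB] /domination_product[xA' yB'].
by rewrite (dA i i' _ _ x) // (dB k k' _ _ y).
Qed.

(** * Orienting a forest *)

(** If every vertex of [W] had two neighbors in [W], then any simple path
in [W] could be prolonged at its head, as a neighbor of the head that lies on
the path further than one step away closes a cycle.  Simple paths would be
arbitrarily long. *)
Lemma acyclic_low_degree (G : graph) (W : {set G}) :
  acyclic G -> W != set0 -> exists2 x, x \in W & #|neighbors x :&: W| <= 1.
Proof.
move=> acG /set0Pn[x0 x0W]; apply/exists_inP.
apply: contraT => /exists_inPn deg2.
have extend n : exists x s, [/\ size s = n, uniq (x :: s),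
    path (@adj G) x s & all (mem W) (x :: s)].
  elim: n => [|n [x [s [sz us ps Ws]]]].
    by exists x0, [::]; split=> //=; rewrite x0W.
  have xW : x \in W by case/andP: Ws.
  (* A neighbor of [x] in [W] other than the next vertex of the path; the
     default [x] for an empty tail is harmless, as [x] is not its own neighbor. *)
  have [y [xy yW yh]] : exists y, [/\ adj x y, y \in W & y != head x s].
    have := deg2 x xW; rewrite -ltnNge => /card_gt1P[y [z [yN zN yz]]].
    move: yN zN; rewrite !inE => /andP[xy yW] /andP[xz zW].
    case: (eqVneq y (head x s)) => [e|ne]; last by exists y.
    by exists z; split=> //; rewrite -e eq_sym.
  have yx : y != x by apply: contraTneq xy => ->; rewrite adj_irr.
  have ys : y \notin s.
    apply/negP=> ys; case/splitPr: ys yh us ps => s1 s2 yh us ps.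
    case: s1 yh us ps => [|z s1] /=; first by rewrite eqxx.
    (* The path from [x] to [y] has a vertex [z] in between. *)
    rewrite -cat_rcons => _ us ps.
    suff cyc : ucycle (@adj G) (x :: z :: rcons s1 y).
      by have := acG _ cyc; rewrite /= size_rcons.
    apply/andP; split.
      rewrite /= rcons_path last_rcons (adj_sym y) xy andbT.
      by move: ps; rewrite cat_path => /and3P[-> ->].
    have : uniq ((x :: z :: rcons s1 y) ++ s2) by [].
    by rewrite cat_uniq => /andP[].
  exists y, (x :: s); split=> //=; rewrite ?sz //.
  - by rewrite inE negb_or yx ys.
  - by rewrite adj_sym xy.
  - by rewrite yW.
have [x [s [sz us _ _]]] := extend #|G|.
by have := max_card (mem (x :: s)); rewrite (card_uniqP us) /= sz ltnn.
Qed.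

(** Roots have parent [None]; the height [h] makes the orientation well
founded and bounds recursions in both directions. *)
Definition forest_order (G : graph) (parent : G -> option G) (h : G -> nat) :=
  (forall x y, adj x y = (parent x == Some y) || (parent y == Some x)) /\
  (forall x y, parent x = Some y -> h x < h y).

(** Repeatedly removing a vertex of degree at most one in what remains gives
an injective height such that each vertex has at most one higher neighbor,
which is its parent. *)
Lemma acyclic_forest_order (G : graph) :
  acyclic G -> exists parent h, @forest_order G parent h.
Proof.
move=> acG.
have [h hinj hup] : exists2 h : G -> nat, injective h &
    forall x y z, adj x y -> adj x z -> h x < h y -> h x < h z -> y = z.
  suff main n (W : {set G}) : #|W| = n -> exists2 h : G -> nat,
      {in W &, injective h} & {in W & &, forall x y z,
        adj x y -> adj x z -> h x < h y -> h x < h z -> y = z}.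
    have [h hinj hup] := main _ [set: G] erefl.
    by exists h => [x y|x y z]; [apply: hinj | apply: hup]; rewrite inE.
  elim: n W => [|n IH] W cW.
    by exists (fun=> 0) => [x|x]; rewrite (cards0_eq cW) inE.
  have W0 : W != set0 by rewrite -card_gt0 cW.
  have [x xW xdeg] := acyclic_low_degree acG W0.
  have [|h hinj hup] := IH (W :\ x).
    by apply/eqP; rewrite -eqSS -cW (cardsD1 x W) xW.
  exists (fun y => if y == x then 0 else (h y).+1) => [y z|y z t] yW zW.
    case: eqVneq => [->|yx]; case: eqVneq => [->|zx] // [] hyz.
    by apply: hinj; rewrite // !inE ?yx ?zx.
  move=> tW yz yt; case: (eqVneq y x) yz yt => [-> xz xt _ _|yx yz yt].
    by apply: (card_le1_eqP xdeg); rewrite !inE ?xz ?zW ?xt ?tW.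
  case: eqVneq => // zx; case: eqVneq => // tx; rewrite !ltnS => yz' yt'.
  by apply: (hup y z t); rewrite // !inE ?yx ?zx ?tx.
pose parent x := [pick y | adj x y & h x < h y].
have parentP x y : parent x = Some y <-> adj x y /\ h x < h y.
  rewrite /parent; case: pickP => [z /andP[xz hxz]|no]; split=> //.
  - by case=> <-.
  - by case=> xy hxy; congr Some; apply: hup hxz hxy.
  - by case=> xy hxy; have := no y; rewrite /= xy hxy.
exists parent, h; split=> [x y|x y /parentP[]//].
apply/idP/orP => [xy|[]/eqP/parentP[]//]; last by rewrite adj_sym.
have : h x != h y.
  by rewrite (inj_eq hinj); apply: contraTneq xy => ->; rewrite adj_irr.
by rewrite neq_ltn => /orP[] lt; [left | right];
  apply/eqP/parentP; rewrite // adj_sym.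
Qed.

(** Iterating [step] more than [m u] times from a constant function stabilizes
the value at [u]. *)
Lemma measure_recursion (T : Type) (X : Type) (m : T -> nat) (x0 : X)
    (step : (T -> X) -> T -> X) :
  (forall f g u, (forall w, m w < m u -> f w = g w) -> step f u = step g u) ->
  exists f, forall u, f u = step f u.
Proof.
move=> ext; pose f n := iter n step (fun=> x0).
have stab n k u : m u < n -> m u < k -> f n u = f k u.
  elim: n k u => // n IH [|k] u //= nu ku; apply: ext => w wu.
  by apply: IH; apply: leq_trans wu _.
exists (fun u => f (m u).+1 u) => u /=; apply: ext => w wu.
exact: (stab (m u) (m w).+1).
Qed.

(** * Power dominating sets of forests and their dual packings *)

Inductive label := Needy | Forcing | Idle.

Definition needy l := if l is Needy then true else false.
Definition forcing l := if l is Forcing then true else false.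

Section Forest.
Variables (G : graph) (parent : G -> option G) (h : G -> nat).
Hypothesis forest : forest_order parent h.

Definition needy_children (f : G -> label) u : {set G} :=
  [set w | (parent w == Some u) && needy (f w)].

(** In the order of the branches: [u] is put in the power dominating set; no
child observes [u], so that [u] waits for its parent and its propagation step
serves its needy child, if any; a child observes [u], whose propagation step
then serves its needy child; or [u] has no needy child and serves its
parent. *)
Definition label_step (f : G -> label) u : label :=
  if 1 < #|needy_children f u| then Forcing
  else if ~~ [exists w, (parent w == Some u) && forcing (f w)] then Needy
  else if needy_children f u != set0 then Idle else Forcing.

Lemma labelling_exists : exists f, forall u, f u = label_step f u.
Proof.
apply: (measure_recursion (m := h) Needy) => f g u fg.
have fg' w : parent w == Some u -> f w = g w.
  by move=> /eqP pw; apply/fg/forest.2.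
have eN : needy_children f u = needy_children g u.
  by apply/setP=> w; rewrite !inE; case: eqP => //= /eqP/fg'->.
rewrite /label_step eN; do 2!congr (if _ then _ else _).
by congr (~~ _); apply: eq_existsb => w; case: eqP => //= /eqP/fg'->.
Qed.

(** The end of the upward trace from [u], which is [None] if the trace does not
reach a center.  An idle vertex separates its needy child from its parent,
and it is only passed through when that parent is needy: a fort of needy vertices
that contains one of these two must contain the other.  If the parent is not needy, then [u] sees
no fort at all. *)
Definition owner_step (f : G -> label) (own : G -> option G) u : option G :=
  match f u, parent u with
  | Needy, None => Some u
  | Needy, Some p => own p
  | Idle, Some p => if needy (f p) then own p else None
  | Idle, None => None
  | Forcing, _ => if 1 < #|needy_children f u| then Some u else None
  end.

Lemma owner_exists f : exists own, forall u, own u = owner_step f own u.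
Proof.
(* Owners are computed from the roots down, hence the reversed height. *)
pose m u := (\max_v h v) - h u.
apply: (measure_recursion (m := m) None) => own own' u e.
have ep p : parent u = Some p -> own p = own' p.
  move=> /forest.2 hp; apply: e; rewrite /m ltn_sub2l //.
  by apply: leq_trans hp _; apply: leq_bigmax.
rewrite /owner_step; case: (f u) (parent u) ep => [] [p|] // ->//.
Qed.

Variable f : G -> label.
Hypothesis fP : forall u, f u = label_step f u.

(** A needy root has no parent to observe it, hence the second part. *)
Definition centers : {set G} :=
  [set u | 1 < #|needy_children f u|] :|:
  [set u | needy (f u) && (parent u == None)].

(** The fort of a center [v] is the set of needy vertices with owner [v].
Owners are constant along every edge with a needy end, so the closed
neighborhood of this fort has owner [v], which gives disjointness.  A vertex
seen by the fort but outside it is either [v] itself, with two needy children,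
or an idle vertex with a needy parent and a needy child. *)
Lemma centers_packing : exists F : G -> {set G}, fort_packing centers F.
Proof.
have [own ownP] := owner_exists f.
exists (fun v => [set u | needy (f u) & own u == Some v]).
have own_needy_child u w : w \in needy_children f u -> own w = own u.
  rewrite inE => /andP[/eqP pw]; rewrite [own w]ownP /owner_step pw.
  by case: (f w).
have own_big u : 1 < #|needy_children f u| -> own u = Some u.
  by move=> big; rewrite ownP /owner_step {1}fP /label_step big.
have own_child u w : needy (f u) -> parent w = Some u -> own w = own u.
  move=> nu pw; rewrite [LHS]ownP /owner_step pw nu.
  case fw: (f w) => //; have : forcing (f w) by rewrite fw.
  move: nu; rewrite fP /label_step; case: ifP => //= _.
  have -> : [exists w, (parent w == Some u) && forcing (f w)].
    by apply/existsP; exists w; rewrite pw eqxx fw.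
  by case: ifP.
have own_adj u w : needy (f w) -> adj u w -> own u = own w.
  rewrite forest.1 => nw /orP[/eqP|/eqP] p; first exact: own_child.
  by symmetry; apply: own_needy_child; rewrite inE p nw eqxx.
have own_dom v u :
    u \in domination [set u | needy (f u) & own u == Some v] -> own u = Some v.
  case/dominationP => [|[w]]; rewrite inE => /andP[nu /eqP<-] //.
  by rewrite adj_sym => /own_adj->.
split=> [v vC|v v' _ _ u /own_dom e /own_dom e']; last first.
  by apply: Some_inj; rewrite -e -e'.
split.
  apply/set0Pn; move: vC; rewrite !inE => /orP[big|/andP[nv /eqP pv]].
    have [w wN] : exists w, w \in needy_children f v.
      by apply/card_gt0P; apply: leq_trans big.
    exists w; rewrite inE (own_needy_child v) // own_big // eqxx andbT.
    by move: wN; rewrite inE => /andP[].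
  by exists v; rewrite inE nv ownP /owner_step pv; case: (f v) nv => //= _;
    rewrite eqxx.
move=> u; rewrite inE negb_and => uF.
case: (set_0Vmem (neighbors u :&: [set u0 | needy (f u0) & own u0 == Some v])).
  by move=> ->; rewrite cards0.
case=> x; rewrite !inE => /and3P[ux nx /eqP ox].
have ou : own u = Some v by rewrite (own_adj _ x).
have nu : ~~ needy (f u) by move: uF; rewrite ou eqxx /= orbF.
suff [y [z [yN zN yz]]] : exists y z,
    [/\ adj u y && (needy (f y) && (own y == Some v)),
        adj u z && (needy (f z) && (own z == Some v)) & y != z].
  by rewrite neq_ltn; apply/orP; right; apply/card_gt1P; exists y, z; rewrite !inE.
have childP w : w \in needy_children f u ->
    adj u w && (needy (f w) && (own w == Some v)).
  move=> wN; rewrite (own_needy_child _ _ wN) ou eqxx andbT.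
  by move: wN; rewrite inE forest.1 => /andP[-> ->]; rewrite orbT.
move: ou; rewrite ownP /owner_step; case fu: (f u) nu => // _.
  case: ifP => // /card_gt1P[y [z [yN zN yz]]] _.
  by exists y, z; split; auto.
case pu: (parent u) => [p|] //; case: ifP => // np op.
have : f u = label_step f u by []; rewrite fu /label_step.
do 2!case: ifP => // _; case: ifP => // /set0Pn[w wN] _.
exists p, w; split; [|exact: childP|].
  by rewrite forest.1 pu eqxx np op eqxx.
move: wN; rewrite inE => /andP[/eqP /forest.2 hw _].
apply: contraTneq hw => <-; rewrite -leqNgt; exact/ltnW/forest.2.
Qed.

(** Upward induction shows that idle and forcing vertices are observed, and so
are the parents of forcing ones.  Downward induction then shows that all
vertices are observed: unless it is a center, the parent of a needy [u] has
no unobserved neighbor other than [u]. *)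
Lemma centers_power_dominating : power_dominating centers.
Proof.
set O := observed centers.
have stable v w : v \in O -> adj v w ->
    (forall x, adj v x -> x != w -> x \in O) -> w \in O.
  move=> vO vw others; apply/negPn/negP => wO.
  have := wO; rewrite /O -propagation_observed -/O in_setU (negPf wO) /= inE.
  move/exists_inPn/(_ v vO)/negP; apply; apply/eqP/setP => x; rewrite !inE.
  case: (eqVneq x w) => [->|xw]; first by rewrite wO.
  by apply/negP=> /andP[/negP xO /others]; auto.
have domO : domination centers \subset O.
  rewrite /O /observed; elim: #|G| => //= n IH.
  exact: subset_trans IH (sub_propagation _).
have cenO v w : v \in centers -> v = w \/ adj v w -> w \in O.
  move=> vC vw; apply: (subsetP domO); apply/dominationP.
  by case: vw => [<-|vw]; [left | right; exists v].
have up n u : h u < n -> ~~ needy (f u) ->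
    u \in O /\ (forcing (f u) -> forall p, parent u = Some p -> p \in O).
  elim: n u => // n IH u; rewrite ltnS => hu.
  have [big _|small] := boolP (1 < #|needy_children f u|).
    have uC : u \in centers by rewrite !inE big.
    split=> [|_ p pu]; first by apply: (cenO u) => //; left.
    by apply: (cenO u) => //; right; rewrite forest.1 pu eqxx.
  rewrite fP /label_step (negPf small).
  case: existsP => [[w /andP[/eqP pw fw]]|_] /=; last by [].
  have hwu := forest.2 _ _ pw.
  have uO : u \in O.
    have [] // := IH w (leq_trans hwu hu); last by move=> _; apply.
    by case: (f w) fw.
  case: ifP => // /negbFE/eqP N0 _; split=> // _ p pu.
  apply: (stable u) => //; first by rewrite forest.1 pu eqxx.
  move=> x; rewrite forest.1 pu => /orP[/eqP[->]|/eqP px _]; first by rewrite eqxx.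
  suff nx : ~~ needy (f x) by have [] := IH x (leq_trans (forest.2 _ _ px) hu) nx.
  apply/negP=> nx; have : x \in needy_children f u by rewrite inE px nx eqxx.
  by rewrite N0 inE.
have upO u : ~~ needy (f u) -> u \in O.
  by move=> nu; have [] := up _ u (ltnSn _) nu.
have all n u : (\max_v h v) - h u < n -> u \in O.
  elim: n u => // n IH u; rewrite ltnS => hu.
  have [nu|/upO//] := boolP (needy (f u)).
  have above w : h u < h w -> w \in O.
    move=> hw; apply: IH; apply: leq_trans hu; apply: ltn_sub2l => //.
    by apply: leq_trans hw _; apply: leq_bigmax.
  case pu: (parent u) => [p|]; last first.
    have uC : u \in centers by rewrite !inE nu pu orbT.
    by apply: (cenO u _ uC); left.
  have hp := forest.2 _ _ pu.
  have pu' : adj p u by rewrite forest.1 pu eqxx orbT.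
  have [big|small] := boolP (1 < #|needy_children f p|).
    have pC : p \in centers by rewrite !inE big.
    by apply: (cenO p _ pC); right.
  apply: (stable p) => //; first exact: above.
  move=> x; rewrite forest.1 => /orP[/eqP/forest.2 hx _|/eqP px xu].
    by apply: above; apply: ltn_trans hx.
  apply: upO; apply: contra small => nx; apply/card_gt1P.
  by exists x, u; rewrite !inE px pu nx nu eqxx.
by apply/eqP/setP => u; rewrite inE; apply: (all _ u (ltnSn _)).
Qed.

End Forest.

(** Strong duality for forests; by [fort_packing_bound] the inequality is
an equality. *)
Lemma acyclic_packing (G : graph) :
  acyclic G -> exists (J : {set G}) (F : G -> {set G}),
    fort_packing J F /\ power_domination_number G <= #|J|.
Proof.
move=> /acyclic_forest_order[parent [h forest]].
have [f fP] := labelling_exists forest.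
have [F packF] := centers_packing forest fP.
exists (centers parent f), F; split=> //.
apply: (power_domination_numberP G).2.
exact (centers_power_dominating forest fP).
Qed.

Theorem theorem2 (T1 T2 : graph) (hT1 : is_tree T1) (hT2 : is_tree T2) :
  power_domination_number T1 * power_domination_number T2
    <= power_domination_number (cartesian_product T1 T2).
Proof.
have [J1 [F1 [pack1 le1]]] := acyclic_packing hT1.2.
have [J2 [F2 [pack2 le2]]] := acyclic_packing hT2.2.
apply: leq_trans (leq_mul le1 le2) _; rewrite -cardsX.
exact: fort_packing_bound (fort_packing_product pack1 pack2).
Qed.
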